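(* Let $E$ be a connected graded Frobenius algebra whose Nakayama automorphism $\mu_E$ restricts to a scalar multiplication on $E_1$. Let $K$ be a Hopf algebra with antipode $S$ such that $E$ is a left $K$-comodule algebra with grading-preserving coaction, the coaction on $E_1$ is inner-faithful, and the homological codeterminant is trivial. Then $S^2=\mathrm{Id}_K$. If in addition $K$ is finite dimensional and $\mathrm{char}\,k$ does not divide $\dim K$, then $H=K^\circ$ is semisimple.
   Context: A connected graded algebra $E$ is Frobenius if it is finite dimensional with a nondegenerate associative graded bilinear form $\langle-,-\rangle$; its Nakayama automorphism $\mu_E$ satisfies $\langle a,b\rangle=\langle b,\mu_E(a)\rangle$. The top nonzero degree of $E$ is one-dimensional, spanned by $\mathfrak e$; the homological codeterminant is the grouplike ${\sf D}\in K$ with $\rho(\mathfrak e)={\sf D}\otimes\mathfrak e$, and it is trivial if ${\sf D}=1_K$. Inner-faithful on $E_1$: $\rho(E_1)\not\subseteq K'\otimes E_1$ for every proper Hopf subalgebra $K'\subsetneq K$. $K^\circ$ is the Hopf dual. *)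

(* Defs.v *)
From HB Require Import structures.
From mathcomp Require Import all_boot all_order all_algebra all_field.
Set Implicit Arguments. Unset Strict Implicit. Unset Printing Implicit Defensive.
Import Order.TTheory GRing.Theory Num.Theory.
Local Open Scope ring_scope.

(* Tensor products over a field k, encoded by finite sums of pure      *)
(* tensors (lists of pairs / triples).  Two lists represent the same    *)
(* element of U (x) V iff they agree under every bilinear map into      *)
(* every k-module (universal property of the tensor product).           *)
Section Tensor.
Variable k : fieldType.

Definition bilin (U V W : lmodType k) (f : U -> V -> W) : Prop :=
  (forall (a : k) x x' y, f (a *: x + x') y = a *: f x y + f x' y) /\
  (forall (a : k) x y y', f x (a *: y + y') = a *: f x y + f x y').

Definition trilin (U V X W : lmodType k) (f : U -> V -> X -> W) : Prop :=
  (forall (a : k) x x' y z, f (a *: x + x') y z = a *: f x y z + f x' y z) /\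
  (forall (a : k) x y y' z, f x (a *: y + y') z = a *: f x y z + f x y' z) /\
  (forall (a : k) x y z z', f x y (a *: z + z') = a *: f x y z + f x y z').

Definition teq (U V : lmodType k) (s t : seq (U * V)) : Prop :=
  forall (W : lmodType k) (f : U -> V -> W), bilin f ->
    \sum_(p <- s) f p.1 p.2 = \sum_(p <- t) f p.1 p.2.

Definition teq3 (U V X : lmodType k) (s t : seq (U * V * X)) : Prop :=
  forall (W : lmodType k) (f : U -> V -> X -> W), trilin f ->
    \sum_(p <- s) f p.1.1 p.1.2 p.2 = \sum_(p <- t) f p.1.1 p.1.2 p.2.

Definition is_hopf (K : algType k) (Delta : K -> seq (K * K)) (eps : K -> k)
    (S : K -> K) : Prop :=
  [/\
      forall (a : k) x y,
        teq (Delta (a *: x + y)) ([seq (a *: p.1, p.2) | p <- Delta x] ++ Delta y),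
      forall x, teq3 [seq (q.1, q.2, p.2) | p <- Delta x, q <- Delta p.1]
                     [seq (p.1, q.1, q.2) | p <- Delta x, q <- Delta p.2],
      (forall (a : k) x y, eps (a *: x + y) = a * eps x + eps y) /\
      (forall x, \sum_(p <- Delta x) eps p.1 *: p.2 = x) /\
      (forall x, \sum_(p <- Delta x) eps p.2 *: p.1 = x),
      (forall x y, teq (Delta (x * y))
                      [seq (p.1 * q.1, p.2 * q.2) | p <- Delta x, q <- Delta y]) /\
      teq (Delta 1) [:: (1, 1)] /\
      (forall x y, eps (x * y) = eps x * eps y) /\ eps 1 = 1 &
      (forall (a : k) x y, S (a *: x + y) = a *: S x + S y) /\
      (forall x, \sum_(p <- Delta x) S p.1 * p.2 = eps x *: 1) /\
      (forall x, \sum_(p <- Delta x) p.1 * S p.2 = eps x *: 1)].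

Definition is_hopf_subalg (K : algType k) (Delta : K -> seq (K * K)) (S : K -> K)
    (K' : K -> Prop) : Prop :=
  [/\ K' 1,
      forall (a : k) x y, K' x -> K' y -> K' (a *: x + y),
      forall x y, K' x -> K' y -> K' (x * y),
      forall x, K' x -> K' (S x) &
      forall x, K' x -> exists s, teq (Delta x) s /\
                     forall p, p \in s -> K' p.1 /\ K' p.2].

Definition is_comod_alg (K : algType k) (E : falgType k)
    (Delta : K -> seq (K * K)) (eps : K -> k) (rho : E -> seq (K * E)) : Prop :=
  [/\ forall (a : k) x y,
        teq (rho (a *: x + y)) ([seq (a *: p.1, p.2) | p <- rho x] ++ rho y),
      forall x, teq3 [seq (q.1, q.2, p.2) | p <- rho x, q <- Delta p.1]
                     [seq (p.1, q.1, q.2) | p <- rho x, q <- rho p.2],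
      forall x, \sum_(p <- rho x) eps p.1 *: p.2 = x,
      forall x y, teq (rho (x * y))
                      [seq (p.1 * q.1, p.2 * q.2) | p <- rho x, q <- rho y] &
      teq (rho 1) [:: (1, 1)]].

Definition is_conn_graded (E : falgType k) (Eg : nat -> {vspace E}) : Prop :=
  [/\ forall n, directv (\sum_(i < n) Eg i),
      exists n, (\sum_(i < n) Eg i)%VS = fullv,
      forall i j x y, x \in Eg i -> y \in Eg j -> x * y \in Eg (i + j) &
      Eg 0%N = <[1 : E]>%VS].

Definition is_graded_frobenius_form (E : falgType k) (Eg : nat -> {vspace E})
    (B : E -> E -> k) : Prop :=
  [/\
      (forall (a : k) x x' y, B (a *: x + x') y = a * B x y + B x' y) /\
      (forall (a : k) x y y', B x (a *: y + y') = a * B x y + B x y'),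
      forall x y z, B (x * y) z = B x (y * z),
      (forall x, (forall y, B x y = 0) -> x = 0) /\
      (forall y, (forall x, B x y = 0) -> y = 0) &
      exists d, forall i j x y, x \in Eg i -> y \in Eg j -> (i + j != d)%N ->
        B x y = 0].

Definition is_nakayama (E : falgType k) (B : E -> E -> k) (mu : E -> E) : Prop :=
  forall a b, B a b = B b (mu a).

(* Finite dimensionality and the dual algebra K^* (= K° when K is      *)
(* finite dimensional), with convolution product.                       *)
Definition fin_dim_with (K : lmodType k) (n : nat) : Prop :=
  exists b : 'I_n -> K,
    (forall c : 'I_n -> k, \sum_(i < n) c i *: b i = 0 -> forall i, c i = 0) /\
    (forall x, exists c : 'I_n -> k, x = \sum_(i < n) c i *: b i).

Definition lin_functional (K : lmodType k) (f : K -> k) : Prop :=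
  forall (a : k) x y, f (a *: x + y) = a * f x + f y.

Definition conv (K : lmodType k) (Delta : K -> seq (K * K)) (f g : K -> k) : K -> k :=
  fun x => \sum_(p <- Delta x) f p.1 * g p.2.

Definition dual_left_ideal (K : lmodType k) (Delta : K -> seq (K * K))
    (I : (K -> k) -> Prop) : Prop :=
  [/\ forall f, I f -> lin_functional f,
      I (fun _ => 0),
      forall f g, I f -> I g -> I (fun x => f x + g x),
      forall (a : k) f, I f -> I (fun x => a * f x) &
      forall h f, lin_functional h -> I f -> I (conv Delta h f)].

Definition dual_semisimple (K : lmodType k) (Delta : K -> seq (K * K)) : Prop :=
  forall I, dual_left_ideal Delta I ->
    exists J, [/\ dual_left_ideal Delta J,
      (forall f, I f -> J f -> forall x, f x = 0) &
      (forall f, lin_functional f ->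
         exists g h, [/\ I g, J h & forall x, f x = g x + h x])].

End Tensor.

(* Main.v *)
(** Choose bases e_i of E_1 and f_j of E_(d-1) dual to each other for the Frobenius form,
    d being the top degree, and let Y, G be the matrices of the coaction on them.
    Triviality of the codeterminant makes the form coinvariant, which gives Y G^T = 1;
    since the Nakayama automorphism is scalar on E_1, also G Y^T = 1.  As S inverts the
    matrix of a comodule, S(Y) = G^T and S(G) = Y^T.  Hence S^2 fixes the entries of Y and
    G, and these generate a Hopf subalgebra, which is K by inner faithfulness.

    If S^2 = id and K is finite dimensional, the trace of left multiplication is an
    integral of K^*, whose value at 1 is dim K.  When this is invertible, averaging a
    linear projection onto a left ideal of K^* against the integral makes its kernel a
    complementary left ideal. *)
Require Import Defs.
From HB Require Import structures.
From mathcomp Require Import all_boot all_algebra all_field.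
From mathcomp Require Import boolp.
Import GRing.Theory.
Set Implicit Arguments. Unset Strict Implicit. Unset Printing Implicit Defensive.
Local Open Scope ring_scope.

(** * Multilinear maps and sums over tensors *)

(* \tsum_(a, b <- Delta x) F is Sweedler's sum of F over a = x_(1), b = x_(2). *)
Definition tsum (U V : Type) (W : nmodType) (f : U -> V -> W) (s : seq (U * V)) : W :=
  \sum_(p <- s) f p.1 p.2.

Notation "\tsum_ ( a , b <- s ) F" := (tsum (fun a b => F) s)
  (at level 41, F at level 41, a name, b name, s at level 50,
   format "\tsum_ ( a ,  b  <-  s )  F").

Lemma eq_tsum (U V : Type) (W : nmodType) (f g : U -> V -> W) s :
  (forall a b, f a b = g a b) -> tsum f s = tsum g s.
Proof. by move=> fg; apply: eq_bigr => p _; apply: fg. Qed.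

Lemma tsum_exchange (U V U' V' : Type) (W : nmodType)
    (f : U -> V -> U' -> V' -> W) s t :
  \tsum_(a, b <- s) \tsum_(c, d <- t) f a b c d
  = \tsum_(c, d <- t) \tsum_(a, b <- s) f a b c d.
Proof. exact: exchange_big. Qed.

Section LinearFor.
Variables (k : fieldType) (U : lmodType k) (W : zmodType).
Variables (s : GRing.Scale.law k W) (f : U -> W).
Hypothesis f_linear : GRing.linear_for s f.

Let f_bundled : {linear U -> W | s} :=
  HB.pack f (GRing.isLinear.Build k U W s f f_linear).

Lemma linear_for0 : f 0 = 0.
Proof. exact: (linear0 f_bundled). Qed.

Lemma linear_forD : {morph f : x y / x + y}.
Proof. exact: (linearD f_bundled). Qed.

Lemma linear_forZ a : {morph f : x / a *: x >-> s a x}.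
Proof. exact: (linearZ_LR f_bundled). Qed.

Lemma linear_for_sum I (r : seq I) (P : pred I) (F : I -> U) :
  f (\sum_(i <- r | P i) F i) = \sum_(i <- r | P i) f (F i).
Proof. exact: (linear_sum f_bundled). Qed.

Lemma linear_for_tsum I J (F : I -> J -> U) r :
  f (tsum F r) = \tsum_(a, b <- r) f (F a b).
Proof. exact: linear_for_sum. Qed.

End LinearFor.

Section Multilinear.
Variable k : fieldType.
Implicit Types T U V X W : lmodType k.

Lemma scaler_tsumr (I J : Type) W (f : I -> J -> W) r a :
  a *: tsum f r = \tsum_(x, y <- r) a *: f x y.
Proof. exact: scaler_sumr. Qed.

Lemma bilinP U V W (f : U -> V -> W) :
  (forall y, linear (f^~ y)) -> (forall x, linear (f x)) -> bilin f.
Proof. by move=> l1 l2; split=> a x *; [apply: l1 | apply: l2]. Qed.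

Lemma trilinP U V X W (f : U -> V -> X -> W) :
  (forall y z, linear (fun x => f x y z)) -> (forall x z, linear (fun y => f x y z)) ->
  (forall x y, linear (f x y)) -> trilin f.
Proof.
by move=> l1 l2 l3; split; [|split] => a x *; [apply: l1 | apply: l2 | apply: l3].
Qed.

Lemma linear_id U : linear (fun x : U => x). Proof. by []. Qed.

Lemma linear_for_comp T U (W : nmodType) (s : k -> W -> W) (f : U -> W) (g : T -> U) :
  GRing.linear_for s f -> linear g -> GRing.linear_for s (fun x => f (g x)).
Proof. by move=> lf lg a x y; rewrite lg lf. Qed.

Lemma bilin_linearl T U V W (f : U -> V -> W) (g : T -> U) c :
  bilin f -> linear g -> linear (fun x => f (g x) c).
Proof. by case=> l1 l2 lg a x y; rewrite lg l1. Qed.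

Lemma bilin_linearr T U V W (f : U -> V -> W) (g : T -> V) c :
  bilin f -> linear g -> linear (fun x => f c (g x)).
Proof. by case=> l1 l2 lg a x y; rewrite lg l2. Qed.

Lemma trilin_linear1 T U V X W (f : U -> V -> X -> W) (g : T -> U) c d :
  trilin f -> linear g -> linear (fun x => f (g x) c d).
Proof. by case=> l1 [l2 l3] lg a x y; rewrite lg l1. Qed.

Lemma trilin_linear2 T U V X W (f : U -> V -> X -> W) (g : T -> V) c d :
  trilin f -> linear g -> linear (fun x => f c (g x) d).
Proof. by case=> l1 [l2 l3] lg a x y; rewrite lg l2. Qed.

Lemma trilin_linear3 T U V X W (f : U -> V -> X -> W) (g : T -> X) c d :
  trilin f -> linear g -> linear (fun x => f c d (g x)).
Proof. by case=> l1 [l2 l3] lg a x y; rewrite lg l3. Qed.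

Lemma bilinZl U V W (f : U -> V -> W) a x y : bilin f -> f (a *: x) y = a *: f x y.
Proof. by move=> bf; rewrite (linear_forZ (bilin_linearl y bf (@linear_id U))). Qed.

Lemma bilinZr U V W (f : U -> V -> W) a x y : bilin f -> f x (a *: y) = a *: f x y.
Proof. by move=> bf; rewrite (linear_forZ (bilin_linearr x bf (@linear_id V))). Qed.

Lemma bilin_suml U V W (f : U -> V -> W) I (r : seq I) (F : I -> U) y : bilin f ->
  f (\sum_(i <- r) F i) y = \sum_(i <- r) f (F i) y.
Proof. by move=> bf; rewrite (linear_for_sum (bilin_linearl y bf (@linear_id U))). Qed.

Lemma bilin_sumr U V W (f : U -> V -> W) I (r : seq I) (F : I -> V) x : bilin f ->
  f x (\sum_(i <- r) F i) = \sum_(i <- r) f x (F i).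
Proof. by move=> bf; rewrite (linear_for_sum (bilin_linearr x bf (@linear_id V))). Qed.

Lemma bilin_tsumr (I J : Type) U V W (f : U -> V -> W) (F : I -> J -> V) r x : bilin f ->
  f x (tsum F r) = \tsum_(a, b <- r) f x (F a b).
Proof. exact: bilin_sumr. Qed.

Lemma linear_scalel T W (f : T -> k) (w : W) : scalar f -> linear (fun x => f x *: w).
Proof. by move=> lf a x y; rewrite lf scalerDl scalerA. Qed.

Lemma linear_scaler T W c (g : T -> W) : linear g -> linear (fun x => c *: g x).
Proof. by move=> lg a x y; rewrite lg scalerDr !scalerA mulrC. Qed.

Lemma linear_mull T (A : algType k) (c : A) (g : T -> A) :
  linear g -> linear (fun x => c * g x).
Proof. by move=> lg a x y; rewrite lg mulrDr scalerAr. Qed.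

Lemma linear_mulr T (A : algType k) (c : A) (g : T -> A) :
  linear g -> linear (fun x => g x * c).
Proof. by move=> lg a x y; rewrite lg mulrDl scalerAl. Qed.

Lemma bilin_mul_scalar U V (f : U -> k) (g : V -> k) :
  scalar f -> scalar g -> bilin (W := k^o) (fun x y => f x * g y).
Proof.
by move=> lf lg; apply: bilinP => y; [apply: linear_scalel | apply: linear_scaler].
Qed.

Lemma linear_for_big T (W : zmodType) (s : GRing.Scale.law k W)
    I (r : seq I) (F : T -> I -> W) :
  (forall i, GRing.linear_for s (F^~ i)) ->
  GRing.linear_for s (fun x => \sum_(i <- r) F x i).
Proof.
move=> lF a x y; have [sa0 saD] := @GRing.Scale.op_nmod_morphism _ _ s a.
rewrite (big_morph _ saD sa0) -big_split /=.
by apply: eq_bigr => i _; apply: lF.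
Qed.

Lemma linear_for_tsum_param T (U V : Type) (W : zmodType) (s : GRing.Scale.law k W)
    (F : T -> U -> V -> W) r :
  (forall a b, GRing.linear_for s (fun x => F x a b)) ->
  GRing.linear_for s (fun x => tsum (F x) r).
Proof. by move=> lF; apply: linear_for_big => p; apply: lF. Qed.

Definition coord_basis V (U : V -> Prop) m (e : 'I_m -> V)
    (xi : 'I_m -> V -> k) : Prop :=
  [/\ forall i, U (e i), forall i, scalar (xi i),
      forall x, U x -> x = \sum_i xi i x *: e i &
      forall i j, xi i (e j) = (i == j)%:R].

Definition tensor_linear T U V (D : T -> seq (U * V)) : Prop :=
  forall a x y, teq (D (a *: x + y)) ([seq (a *: p.1, p.2) | p <- D x] ++ D y).

Definition tensor_in U V (P : U -> Prop) (Q : V -> Prop) (s : seq (U * V)) : Prop :=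
  exists t, teq s t /\ forall p, p \in t -> P p.1 /\ Q p.2.

Lemma tensor_linear_tsum T T' U V W (D : T' -> seq (U * V)) (f : U -> V -> W)
    (g : T -> T') :
  tensor_linear D -> bilin f -> linear g -> linear (fun x => tsum f (D (g x))).
Proof.
move=> lD bf lg a x y; rewrite lg.
have := lD a (g x) (g y) W f bf; rewrite big_cat big_map /= -/(tsum _ _) => ->.
congr (_ + _); rewrite scaler_sumr; apply: eq_bigr => p _; exact: bilinZl.
Qed.

End Multilinear.

Section Comodule.
Variables (k : fieldType) (K : lmodType k).
Variables (Delta : K -> seq (K * K)) (eps : K -> k).

Definition is_comodule (V : lmodType k) (rho : V -> seq (K * V)) : Prop :=
  [/\ tensor_linear rho,
      forall x, teq3 [seq (q.1, q.2, p.2) | p <- rho x, q <- Delta p.1]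
                     [seq (p.1, q.1, q.2) | p <- rho x, q <- rho p.2] &
      forall x, \tsum_(a, b <- rho x) eps a *: b = x].

Definition is_coalgebra : Prop :=
  [/\ scalar eps, is_comodule Delta & forall x, \tsum_(a, b <- Delta x) eps b *: a = x].

Lemma regular_comodule : is_coalgebra -> is_comodule Delta.
Proof. by case. Qed.

Lemma linear_coact (V T W : lmodType k) (rho : V -> seq (K * V)) (f : K -> V -> W)
    (g : T -> V) :
  is_comodule rho -> bilin f -> linear g -> linear (fun x => tsum f (rho (g x))).
Proof. by case=> lrho _ _; apply: tensor_linear_tsum. Qed.

Definition subcomodule (V : lmodType k) (rho : V -> seq (K * V)) (U : V -> Prop) : Prop :=
  forall x, U x -> exists s, teq (rho x) s /\ forall p, p \in s -> U p.2.

Definition coef (V : lmodType k) (rho : V -> seq (K * V)) (xi : V -> k) (x : V) : K :=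
  \tsum_(a, b <- rho x) xi b *: a.

Definition coef_mx (V : lmodType k) (rho : V -> seq (K * V)) m (e : 'I_m -> V)
    (xi : 'I_m -> V -> k) : 'M[K]_m :=
  \matrix_(i, j) coef rho (xi j) (e i).

Definition comatrix m (M : 'M[K]_m) : Prop :=
  (forall i j, teq (Delta (M i j)) [seq (M i s, M s j) | s <- enum 'I_m]) /\
  map_mx eps M = 1%:M.

End Comodule.

Ltac linear_step F :=
  match F with
  | fun x => x => exact: linear_id
  | fun x => ?f _ =>
      match goal with
      | H : GRing.linear_for _ f |- _ => apply: (linear_for_comp H)
      | H : forall _, GRing.linear_for _ _ |- _ => apply: (linear_for_comp (H _))
      end
  | fun x => ?f _ _ =>
      match goal with
      | H : bilin f |- _ =>
          first [apply: (bilin_linearl _ H) | apply: (bilin_linearr _ H)]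
      end
  | fun x => ?f _ _ _ =>
      match goal with
      | H : trilin f |- _ =>
          first [ apply: (trilin_linear1 _ _ H) | apply: (trilin_linear2 _ _ H)
                | apply: (trilin_linear3 _ _ H)]
      end
  | fun x => tsum _ (?rho _) =>
      match goal with
      | H : is_comodule _ _ rho |- _ => apply: (linear_coact H)
      | H : is_coalgebra rho _ |- _ => apply: (linear_coact (regular_comodule H))
      end
  | fun x => tsum _ _ => apply: linear_for_tsum_param
  | fun x => _ * _ => first [apply: linear_mull | apply: linear_mulr]
  | fun x => _ *: _ => first [apply: linear_scaler | apply: linear_scalel]
  end.

Ltac multilinear_step :=
  first
  [ assumption
  | match goal with
    | |- bilin _ => apply: bilinP => ? /=
    | |- trilin _ => apply: trilinP => ? ? /=
    | H : forall _, GRing.linear_for _ _ |- _ => exact: H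
    | |- GRing.linear_for _ ?F => linear_step F
    | |- GRing.linear_for ?s (?f ?c) => change (GRing.linear_for s (fun x => f c x))
    end].

Ltac multilinear := repeat (intros; multilinear_step).

Section ComoduleTheory.
Variables (k : fieldType) (K : lmodType k).
Variables (Delta : K -> seq (K * K)) (eps : K -> k).
Hypothesis coalgK : is_coalgebra Delta eps.
Variables (V : lmodType k) (rho : V -> seq (K * V)).
Hypothesis comodV : is_comodule Delta eps rho.

Let counit_scalar : scalar eps. Proof. by case: coalgK. Qed.

Lemma coact_coassoc (W : lmodType k) (f : K -> K -> V -> W) x : trilin f ->
  \tsum_(p, c <- rho x) \tsum_(a, b <- Delta p) f a b c
  = \tsum_(a, p <- rho x) \tsum_(b, c <- rho p) f a b c.
Proof.
case: comodV => _ coassoc _ tf; have := coassoc x W f tf.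
by rewrite !big_allpairs_dep.
Qed.

Lemma coact_counit (W : lmodType k) (g : V -> W) x : linear g ->
  \tsum_(a, b <- rho x) eps a *: g b = g x.
Proof.
case: comodV => _ _ counit lg; rewrite -[in RHS](counit x) (linear_for_tsum lg).
by apply: eq_tsum => a b; rewrite (linear_forZ lg).
Qed.

Lemma comul_counitr (W : lmodType k) (g : K -> W) x : linear g ->
  \tsum_(a, b <- Delta x) eps b *: g a = g x.
Proof.
case: coalgK => _ _ counitr lg; rewrite -[in RHS](counitr x) (linear_for_tsum lg).
by apply: eq_tsum => a b; rewrite (linear_forZ lg).
Qed.

Lemma coact_cancel_middle (X W : lmodType k) (mu : K -> K -> X) (u : X)
    (f : K -> X -> V -> W) x :
  bilin mu -> (forall y, tsum mu (Delta y) = eps y *: u) -> trilin f ->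
  \tsum_(p, q <- rho x) \tsum_(a, b <- Delta p) \tsum_(c, d <- rho q) f a (mu b c) d
  = \tsum_(a, d <- rho x) f a u d.
Proof.
move=> bmu muE tf.
rewrite (coact_coassoc (f := fun a b q => \tsum_(c, d <- rho q) f a (mu b c) d));
  last by multilinear.
apply: eq_tsum => a p.
rewrite -(coact_coassoc (f := fun b c d => f a (mu b c) d)); last by multilinear.
rewrite -(coact_counit (g := f a u)); last by multilinear.
apply: eq_tsum => q d; have lf : linear (fun y => f a y d) by multilinear.
by rewrite -(linear_for_tsum lf) muE (linear_forZ lf).
Qed.

Lemma coef_linear xi : scalar xi -> linear (coef rho xi).
Proof. by move=> lxi; rewrite /coef; multilinear. Qed.

Lemma comul_coef (W : lmodType k) (f : K -> K -> W) xi x : scalar xi -> bilin f ->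
  tsum f (Delta (coef rho xi x)) = \tsum_(a, b <- rho x) f a (coef rho xi b).
Proof.
move=> lxi bf; have lD : linear (fun y => tsum f (Delta y)) by multilinear.
rewrite (linear_for_tsum lD).
transitivity (\tsum_(p, c <- rho x) \tsum_(a, b <- Delta p) xi c *: f a b).
  by apply: eq_tsum => p c; rewrite (linear_forZ lD) /= scaler_tsumr.
rewrite coact_coassoc; last by multilinear.
apply: eq_tsum => a p; rewrite bilin_tsumr //.
by apply: eq_tsum => b c; rewrite bilinZr.
Qed.

Lemma counit_coef xi x : scalar xi -> eps (coef rho xi x) = xi x.
Proof.
move=> lxi; case: comodV => _ _ counit.
rewrite (linear_for_tsum counit_scalar) -[in RHS](counit x) (linear_for_tsum lxi).
by apply: eq_tsum => a b; rewrite (linear_forZ counit_scalar) (linear_forZ lxi) /= mulrC.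
Qed.

Section CoordinateBasis.
Variables (U : V -> Prop) (m : nat) (e : 'I_m -> V) (xi : 'I_m -> V -> k).
Hypothesis subU : subcomodule rho U.
Hypothesis basisU : coord_basis U e xi.

Let xi_scalar i : scalar (xi i). Proof. by case: basisU. Qed.

Lemma coact_expand (W : lmodType k) (f : K -> V -> W) x : U x -> bilin f ->
  tsum f (rho x) = \sum_i f (coef rho (xi i) x) (e i).
Proof.
move=> Ux bf; have [s [rho_s sU]] := subU Ux; have [_ _ spanU _] := basisU.
transitivity (tsum f s); first exact: rho_s.
transitivity (\sum_(p <- s) \sum_i xi i p.2 *: f p.1 (e i)).
  rewrite /tsum big_seq [RHS]big_seq; apply: eq_bigr => p /sU/spanU {1}->.
  by rewrite bilin_sumr //; apply: eq_bigr => i _; rewrite bilinZr.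
rewrite exchange_big; apply: eq_bigr => i _.
have -> : coef rho (xi i) x = \tsum_(a, b <- s) xi i b *: a.
  by apply: rho_s; multilinear.
by rewrite bilin_suml //; apply: eq_bigr => p _; rewrite bilinZl.
Qed.

Lemma coef_expand zeta x : scalar zeta -> U x ->
  coef rho zeta x = \sum_i xi i x *: coef rho zeta (e i).
Proof.
move=> lz Ux; have [_ _ spanU _] := basisU; have lc := coef_linear lz.
rewrite {1}(spanU x Ux) (linear_for_sum lc).
by apply: eq_bigr => i _; rewrite (linear_forZ lc).
Qed.

Lemma coef_comatrix : comatrix Delta eps (coef_mx rho e xi).
Proof.
have [Ue _ _ xi_e] := basisU; split=> [i j W f bf|].
  have lc := coef_linear (xi_scalar j).
  rewrite big_map big_enum /= mxE -/(tsum f _) comul_coef // coact_expand //.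
    by apply: eq_bigr => s _; rewrite !mxE.
  by multilinear.
by apply/matrixP=> i j; rewrite !mxE counit_coef // xi_e eq_sym.
Qed.

End CoordinateBasis.

End ComoduleTheory.

Section Coalgebra.
Variables (k : fieldType) (K : lmodType k).
Variables (Delta : K -> seq (K * K)) (eps : K -> k).
Hypothesis coalgK : is_coalgebra Delta eps.

(* If T a b c = F a * G b * H c for a product *, the hypotheses say that G * H and
   F * G are the unit of the convolution algebra, so that F = F * G * H = H. *)
Lemma convolution_inverse_unique (W : lmodType k) (T : K -> K -> K -> W) (F H : K -> W) :
  trilin T -> linear F -> linear H ->
  (forall a x, tsum (T a) (Delta x) = eps x *: F a) ->
  (forall x c, \tsum_(a, b <- Delta x) T a b c = eps x *: H c) ->
  forall x, F x = H x.
Proof.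
move=> tT lF lH TF TH x; have comodK := regular_comodule coalgK.
rewrite -(comul_counitr coalgK x lF) -(coact_counit comodK x lH).
transitivity (\tsum_(a, p <- Delta x) \tsum_(b, c <- Delta p) T a b c).
  by apply: eq_tsum => a p; rewrite TF.
by rewrite -(coact_coassoc comodK) //; apply: eq_tsum.
Qed.

Lemma comul_comatrix m (M : 'M[K]_m) (W : lmodType k) (f : K -> K -> W) i j :
  comatrix Delta eps M -> bilin f ->
  tsum f (Delta (M i j)) = \sum_s f (M i s) (M s j).
Proof. by case=> DM _ bf; rewrite /tsum (DM i j W f bf) big_map big_enum. Qed.

Lemma comatrix_convolution m (M : 'M[K]_m) (W : lmodType k) (mu : K -> K -> W) (u : W)
    i j :
  comatrix Delta eps M -> bilin mu -> (forall x, tsum mu (Delta x) = eps x *: u) ->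
  \sum_s mu (M i s) (M s j) = u *+ (i == j).
Proof.
move=> cM bmu muE; rewrite -comul_comatrix // muE.
by have [_ /matrixP/(_ i j)] := cM; rewrite !mxE => ->; rewrite scaler_nat.
Qed.

End Coalgebra.

(** * Hopf algebras *)

Section HopfAlgebra.
Variables (k : fieldType) (K : algType k) (Delta : K -> seq (K * K)).
Variables (eps : K -> k) (S : K -> K).
Hypothesis hopfK : is_hopf Delta eps S.

Lemma hopf_coalgebra : is_coalgebra Delta eps.
Proof. by case: hopfK => lD coassoc [counit_scalar [counitl counitr]] _ _. Qed.

Lemma antipode_linear : linear S. Proof. by case: hopfK => _ _ _ _ []. Qed.

Lemma counit1 : eps 1 = 1. Proof. by case: hopfK => _ _ _ [_ [_ []]]. Qed.

Lemma counitM x y : eps (x * y) = eps x * eps y.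
Proof. by case: hopfK => _ _ _ [_ [_ [eM _]]] _; apply: eM. Qed.

Let coalgK := hopf_coalgebra.
Let comodK := regular_comodule coalgK.
Let S_linear := antipode_linear.
Let counit_scalar : scalar eps. Proof. by case: coalgK. Qed.

Lemma comulM (W : lmodType k) (f : K -> K -> W) x y : bilin f ->
  tsum f (Delta (x * y))
  = \tsum_(a, b <- Delta x) \tsum_(c, d <- Delta y) f (a * c) (b * d).
Proof.
case: hopfK => _ _ _ [DM _] _ bf; have := DM x y W f bf.
by rewrite big_allpairs_dep.
Qed.

Lemma comul1 (W : lmodType k) (f : K -> K -> W) : bilin f -> tsum f (Delta 1) = f 1 1.
Proof.
by case: hopfK => _ _ _ [_ [D1 _]] _ bf; rewrite /tsum D1 // big_seq1.
Qed.

Lemma antipodel (W : lmodType k) (g : K -> W) x : linear g ->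
  \tsum_(a, b <- Delta x) g (S a * b) = eps x *: g 1.
Proof.
case: hopfK => _ _ _ _ [_ [SK _]] lg.
by rewrite -(linear_forZ lg) -SK (linear_for_sum lg).
Qed.

Lemma antipoder (W : lmodType k) (g : K -> W) x : linear g ->
  \tsum_(a, b <- Delta x) g (a * S b) = eps x *: g 1.
Proof.
case: hopfK => _ _ _ _ [_ [_ SK]] lg.
by rewrite -(linear_forZ lg) -SK (linear_for_sum lg).
Qed.

Lemma antipode1 : S 1 = 1.
Proof.
have := antipodel 1 (@linear_id k K); rewrite comul1 ?mulr1; last by multilinear.
by rewrite counit1 scale1r.
Qed.

(* Both sides are convolution inverses of the product K (x) K -> K.  Expanding the
   coproduct of y inside T leaves a convolution in the single variable x. *)
Lemma antipodeM x y : S (x * y) = S y * S x.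
Proof.
pose T a b c := \tsum_(u, q <- Delta y) \tsum_(v, w <- Delta q)
  S (a * u) * (b * v * (S w * S c)).
move: x; apply: (convolution_inverse_unique coalgK (T := T)
  (F := fun a => S (a * y)) (H := fun c => S y * S c)); try by rewrite /T; multilinear.
- move=> a p; rewrite /T tsum_exchange.
  rewrite -(comul_counitr coalgK (g := fun u => S (a * u)) y); last by multilinear.
  rewrite scaler_tsumr; apply: eq_tsum => u q.
  transitivity (\tsum_(b, c <- Delta p) eps q *: (S (a * u) * (b * S c))).
    apply: eq_tsum => b c; rewrite -[b in RHS]mulr1.
    rewrite -(antipoder (g := fun z => S (a * u) * (b * z * S c))); last by multilinear.
    by apply: eq_tsum => v w; rewrite !mulrA.
  rewrite (antipoder (g := fun z => eps q *: (S (a * u) * z))); last by multilinear.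
  by rewrite mulr1.
- move=> p c.
  transitivity (\tsum_(a, b <- Delta p) \tsum_(q, w <- Delta y) \tsum_(u, v <- Delta q)
    S (a * u) * (b * v * (S w * S c))).
    apply: eq_tsum => a b.
    by rewrite (coact_coassoc comodK
      (f := fun u v w => S (a * u) * (b * v * (S w * S c)))) //; multilinear.
  rewrite tsum_exchange -(coact_counit comodK (g := fun z => S z * S c));
    last by multilinear.
  rewrite scaler_tsumr; apply: eq_tsum => q w.
  rewrite scalerA -counitM -[S w * S c in RHS]mul1r.
  rewrite -(antipodel (g := fun z => z * (S w * S c))); last by multilinear.
  rewrite (comulM (f := fun s t => S s * t * (S w * S c))); last by multilinear.
  by do 2!apply: eq_tsum => ? ?; rewrite !mulrA.
Qed.

(* Both sides are convolution inverses of the coproduct K -> K (x) K. *)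
Lemma comul_antipode (W : lmodType k) (f : K -> K -> W) x : bilin f ->
  tsum f (Delta (S x)) = \tsum_(a, b <- Delta x) f (S b) (S a).
Proof.
move=> bf; pose g c u v := \tsum_(s, t <- Delta c) f (u * S t) (v * S s).
have bg c : bilin (g c) by rewrite /g; multilinear.
pose T a b c := \tsum_(u, v <- Delta (S a)) \tsum_(s, t <- Delta b) g c (u * s) (v * t).
move: x; apply: (convolution_inverse_unique coalgK (T := T)
  (F := fun a => tsum f (Delta (S a)))
  (H := fun c => \tsum_(a, b <- Delta c) f (S b) (S a)));
  try by rewrite /T /g; multilinear.
- move=> a x; rewrite /T tsum_exchange scaler_tsumr.
  apply: eq_tsum => u v; rewrite -(mulr1 u) -(antipoder (g := fun z => f (u * z) v));
    last by multilinear.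
  rewrite mulr1 -[v in RHS]mulr1.
  transitivity (\tsum_(b, t <- Delta x) f (u * (b * S t)) (v * 1));
    last by apply: eq_tsum.
  rewrite -(coact_cancel_middle comodK (mu := fun b c => b * S c)
     (f := fun b z t => f (u * (b * S t)) (v * z))) /=.
  + by rewrite /g; do 3!apply: eq_tsum => ? ?; rewrite !mulrA.
  + by multilinear.
  + by move=> y; apply: (antipoder y (@linear_id _ _)).
  + by multilinear.
- move=> x c; have bgc := bg c.
  transitivity (\tsum_(a, b <- Delta x) tsum (g c) (Delta (S a * b))).
    by apply: eq_tsum => a b; rewrite comulM.
  rewrite (antipodel (g := fun z => tsum (g c) (Delta z))); last by multilinear.
  by rewrite comul1 // /g; congr (_ *: _); apply: eq_tsum => s t; rewrite !mul1r.
Qed.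

Lemma comatrix_antipodel m (M : 'M[K]_m) :
  comatrix Delta eps M -> map_mx S M *m M = 1%:M.
Proof.
move=> cM; apply/matrixP => i j; rewrite !mxE.
rewrite -(comatrix_convolution (mu := fun a b => S a * b) i j cM) => [||x].
- by apply: eq_bigr => s _; rewrite mxE.
- by multilinear.
- exact: (antipodel x (@linear_id _ _)).
Qed.

Lemma comatrix_antipoder m (M : 'M[K]_m) :
  comatrix Delta eps M -> M *m map_mx S M = 1%:M.
Proof.
move=> cM; apply/matrixP => i j; rewrite !mxE.
rewrite -(comatrix_convolution (mu := fun a b => a * S b) i j cM) => [||x].
- by apply: eq_bigr => s _; rewrite mxE.
- by multilinear.
- exact: (antipoder x (@linear_id _ _)).
Qed.

Lemma comatrix_antipode m (M N : 'M[K]_m) :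
  comatrix Delta eps M -> M *m N = 1%:M -> map_mx S M = N.
Proof. by move=> /comatrix_antipodel SM MN; rewrite -[N]mul1mx -SM -mulmxA MN mulmx1. Qed.

End HopfAlgebra.

(** * Generated Hopf subalgebras and inner faithfulness *)

Section TensorOperations.
Variable k : fieldType.

Lemma teq_linear (U V : lmodType k) (s s' t t' : seq (U * V)) (a : k) :
  teq s s' -> teq t t' ->
  teq ([seq (a *: p.1, p.2) | p <- s] ++ t) ([seq (a *: p.1, p.2) | p <- s'] ++ t').
Proof.
move=> ss' tt' W f bf; rewrite !big_cat !big_map /= tt' //; congr (_ + _).
by apply: (ss' W (fun x y => f (a *: x) y)); multilinear.
Qed.

Lemma teq_mul (A B : algType k) (s s' t t' : seq (A * B)) :
  teq s s' -> teq t t' ->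
  teq [seq (p.1 * q.1, p.2 * q.2) | p <- s, q <- t]
      [seq (p.1 * q.1, p.2 * q.2) | p <- s', q <- t'].
Proof.
move=> ss' tt' W f bf; rewrite !big_allpairs_dep /=.
transitivity (\tsum_(a, b <- s) \tsum_(c, d <- t') f (a * c) (b * d)).
  apply: eq_bigr => p _.
  by apply: (tt' W (fun c d => f (p.1 * c) (p.2 * d))); multilinear.
by apply: (ss' W (fun a b => \tsum_(c, d <- t') f (a * c) (b * d))); multilinear.
Qed.

End TensorOperations.

Section GeneratedSubalgebra.
Variables (k : fieldType) (K : algType k).

Inductive generated (X : K -> Prop) : K -> Prop :=
| generated_mem x of X x : generated X x
| generated1 : generated X 1
| generated_linear a x y of generated X x & generated X y : generated X (a *: x + y)
| generatedM x y of generated X x & generated X y : generated X (x * y).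

Variables (Delta : K -> seq (K * K)) (eps : K -> k) (S : K -> K).
Hypothesis hopfK : is_hopf Delta eps S.
Variable X : K -> Prop.

Lemma generated_hopf_subalg :
  (forall x, X x -> X (S x)) -> (forall x, X x -> tensor_in X X (Delta x)) ->
  is_hopf_subalg Delta S (generated X).
Proof.
move=> XS XD.
split; [exact: generated1 | exact: generated_linear | exact: generatedM | |] => x.
  elim=> {x} [x /XS/generated_mem // | | a x y _ gx _ gy | x y _ gx _ gy].
  - by rewrite (antipode1 hopfK); apply: generated1.
  - by rewrite (antipode_linear hopfK); apply: generated_linear.
  - by rewrite (antipodeM hopfK); apply: generatedM.
case: hopfK => Dlin _ _ [DM [D1 _]] _.
elim=> {x} [x /XD[s [Ds sX]] | | a x y gx [s [Ds gs]] _ [t [Dt gt]]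
           | x y _ [s [Ds gs]] _ [t [Dt gt]]].
- by exists s; split=> // p /sX[]; split; apply: generated_mem.
- by exists [:: (1, 1)]; split=> // p; rewrite inE => /eqP->; split; apply: generated1.
- exists ([seq (a *: p.1, p.2) | p <- s] ++ t); split=> [W f bf | p].
    by rewrite Dlin // (teq_linear a Ds Dt).
  rewrite mem_cat => /orP[/mapP[q /gs[g1 g2] ->] | /gt//]; split=> //=.
  have := generated_linear a g1 (generated_linear (-1) g1 g1).
  by rewrite scaleN1r addNr addr0.
- exists [seq (p.1 * q.1, p.2 * q.2) | p <- s, q <- t]; split=> [W f bf | p].
    by rewrite DM // (teq_mul Ds Dt).
  by move=> /allpairsP[[q r] /= [/gs[g1 g2] /gt[h1 h2] ->]]; split; apply: generatedM.
Qed.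

Lemma generated_antipode_involutive :
  (forall x, X x -> S (S x) = x) -> forall x, generated X x -> S (S x) = x.
Proof.
move=> XS x; elim=> {x} [x /XS // | | a x y _ Sx _ Sy | x y _ Sx _ Sy].
- by rewrite !(antipode1 hopfK).
- by rewrite !(antipode_linear hopfK) Sx Sy.
- by rewrite !(antipodeM hopfK) Sx Sy.
Qed.

End GeneratedSubalgebra.

Section InnerFaithful.
Variables (k : fieldType) (K : algType k) (Delta : K -> seq (K * K)).
Variables (eps : K -> k) (S : K -> K).
Hypothesis hopfK : is_hopf Delta eps S.

Let coalgK := hopf_coalgebra hopfK.

Definition inner_faithful (V : lmodType k) (rho : V -> seq (K * V)) (U : V -> Prop) :
    Prop :=
  forall K' : K -> Prop, is_hopf_subalg Delta S K' -> (exists x, ~ K' x) ->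
  exists x, U x /\ ~ tensor_in K' U (rho x).

Definition entry m (M : 'M[K]_m) (x : K) : Prop := exists i j, x = M i j.

Lemma comul_entry m (M : 'M[K]_m) x :
  comatrix Delta eps M -> entry M x -> tensor_in (entry M) (entry M) (Delta x).
Proof.
move=> [DM _] [i [j ->]]; exists [seq (M i s, M s j) | s <- enum 'I_m].
split=> // p /mapP[s _ ->]; split; first by exists i, s.
by exists s, j.
Qed.

Lemma generated_entries_hopf_subalg m (Y G : 'M[K]_m) :
  comatrix Delta eps Y -> comatrix Delta eps G ->
  map_mx S Y = G^T -> map_mx S G = Y^T ->
  is_hopf_subalg Delta S (generated (fun x => entry Y x \/ entry G x)).
Proof.
move=> cY cG /matrixP SY /matrixP SG; apply: (generated_hopf_subalg hopfK) => x.
  case=> -[i [j ->]]; [right | left]; exists j, i.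
    by have := SY i j; rewrite !mxE.
  by have := SG i j; rewrite !mxE.
case=> /comul_entry => [/(_ cY) | /(_ cG)] [s [Ds sM]]; exists s; split=> // p /sM[].
  by split; left.
by split; right.
Qed.

Section Coefficients.
Variables (V : lmodType k) (rho : V -> seq (K * V)) (U : V -> Prop).
Variables (m : nat) (e : 'I_m -> V) (xi : 'I_m -> V -> k).
Hypothesis comodV : is_comodule Delta eps rho.
Hypothesis subU : subcomodule rho U.
Hypothesis basisU : coord_basis U e xi.
Hypothesis innerU : inner_faithful rho U.

Lemma inner_faithful_full (K' : K -> Prop) : is_hopf_subalg Delta S K' ->
  (forall i j, K' (coef_mx rho e xi i j)) -> forall x, K' x.
Proof.
move=> hopfK' coefK' x; apply: contrapT => K'x.
have [Ue xi_scalar _ _] := basisU; have [K'1 K'lin _ _ _] := hopfK'.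
have [|y [Uy []]] := innerU hopfK'; first by exists x.
exists [seq (coef rho (xi i) y, e i) | i <- enum 'I_m]; split=> [W f bf | p].
  by rewrite big_map big_enum; apply: (coact_expand subU basisU).
case/mapP=> j _ -> /=; split=> //; rewrite (coef_expand comodV basisU) //.
have K'0 : K' 0 by have := K'lin (-1) 1 1 K'1 K'1; rewrite scaleN1r addNr.
apply: big_rec => // i z _ K'z; apply: K'lin => //.
by have := coefK' i j; rewrite mxE.
Qed.

Lemma inner_faithful_antipode_involutive (G : 'M[K]_m) :
  comatrix Delta eps G -> coef_mx rho e xi *m G^T = 1%:M ->
  G *m (coef_mx rho e xi)^T = 1%:M -> forall x, S (S x) = x.
Proof.
set Y := coef_mx rho e xi => cG YG GY x.
have cY : comatrix Delta eps Y := coef_comatrix coalgK comodV subU basisU.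
have SY := comatrix_antipode hopfK cY YG; have SG := comatrix_antipode hopfK cG GY.
have hopfYG := generated_entries_hopf_subalg cY cG SY SG.
have SSY : map_mx S (map_mx S Y) = Y by rewrite SY -map_trmx SG trmxK.
have SSG : map_mx S (map_mx S G) = G by rewrite SG -map_trmx SY trmxK.
apply: (generated_antipode_involutive hopfK (X := fun x => entry Y x \/ entry G x)).
  by move=> z [] [i [j ->]]; [rewrite -[in RHS]SSY | rewrite -[in RHS]SSG]; rewrite !mxE.
apply: (inner_faithful_full hopfYG) => i j.
by apply: generated_mem; left; exists i, j.
Qed.

End Coefficients.
End InnerFaithful.

(** * Coinvariant bilinear forms *)

Section BilinearForms.
Variable k : fieldType.

Definition bilinear_form (V : lmodType k) (B : V -> V -> k) : Prop :=
  (forall y, scalar (B^~ y)) /\ (forall x, scalar (B x)).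

Definition perfect_pairing (E : vectType k) (B : E -> E -> k) (U V : {vspace E}) : Prop :=
  (forall x, x \in U -> (forall y, y \in V -> B x y = 0) -> x = 0) /\
  (forall y, y \in V -> (forall x, x \in U -> B x y = 0) -> y = 0).

Definition gram_mx (E : vectType k) (B : E -> E -> k) (U V : {vspace E}) :
    'M[k]_(\dim U, \dim V) :=
  \matrix_(i, j) B (vbasis U)`_i (vbasis V)`_j.

Section DualBases.
Variables (E : vectType k) (B : E -> E -> k) (U V : {vspace E}).
Hypothesis formB : bilinear_form B.
Hypothesis pairingUV : perfect_pairing B U V.

Let linBl := proj1 formB.
Let linBr := proj2 formB.

Lemma perfect_pairing_gram_row_free : row_free (gram_mx B U V).
Proof.
apply/inj_row_free => v v_gram; pose x := \sum_i v 0 i *: (vbasis U)`_i.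
suff x0 : x = 0.
  by apply/rowP=> i; rewrite mxE; have /freeP := basis_free (vbasisP U); apply; exact: x0.
apply: (proj1 pairingUV) => [|y Vy].
  by apply: rpred_sum => i _; apply/rpredZ/vbasis_mem/mem_nth; rewrite size_tuple.
rewrite (coord_vbasis Vy) (linear_for_sum (linBr x)) big1 // => j _.
rewrite (linear_forZ (linBr x)) (linear_for_sum (linBl _)) /=.
have /rowP/(_ j) := v_gram; rewrite !mxE => vj.
rewrite -[RHS](mulr0 (coord (vbasis V) j y)) -[in RHS]vj; congr (_ * _).
by apply: eq_bigr => i _; rewrite (linear_forZ (linBl _)) mxE.
Qed.

Lemma dual_bases : exists (m : nat) (e f : 'I_m -> E),
  coord_basis (fun x => x \in U) e (fun i => B^~ (f i)) /\
  coord_basis (fun y => y \in V) f (fun i => B (e i)).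
Proof.
have /row_freeP[N gramN] := perfect_pairing_gram_row_free.
pose e (i : 'I_(\dim U)) := (vbasis U)`_i.
pose f j := \sum_i N i j *: (vbasis V)`_i.
have Ue i : e i \in U by apply/vbasis_mem/mem_nth; rewrite size_tuple.
have Vf i : f i \in V.
  by apply: rpred_sum => j _; apply/rpredZ/vbasis_mem/mem_nth; rewrite size_tuple.
have ef i j : B (e i) (f j) = (i == j)%:R.
  have /matrixP/(_ i j) := gramN; rewrite !mxE => <-; rewrite (linear_for_sum (linBr _)).
  by apply: eq_bigr => l _; rewrite (linear_forZ (linBr _)) mxE /= mulrC.
have spanU x : x \in U -> x = \sum_i B x (f i) *: e i.
  move=> Ux; rewrite {1}(coord_vbasis Ux); apply: eq_bigr => i _; congr (_ *: _).
  rewrite {2}(coord_vbasis Ux) (linear_for_sum (linBl _)) (bigD1 i) //= big1 => [|j].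
    by rewrite (linear_forZ (linBl _)) ef eqxx /= mulr1 addr0.
  by rewrite (linear_forZ (linBl _)) ef => /negPf-> /=; rewrite mulr0.
exists (\dim U), e, f; split; split=> //; first by move=> i j; rewrite ef eq_sym.
move=> y Vy; apply/eqP; rewrite -subr_eq0.
apply/eqP/(proj2 pairingUV) => [|x Ux].
  by rewrite rpredB // rpred_sum // => i _; apply: rpredZ.
suff Be i : B (e i) (y - \sum_j B (e j) y *: f j) = 0.
  rewrite (spanU x Ux) (linear_for_sum (linBl _)) big1 // => i _.
  by rewrite (linear_forZ (linBl _)) Be /= mulr0.
rewrite addrC -scaleN1r linBr (linear_for_sum (linBr _)) (bigD1 i) //= big1 => [|j].
  by rewrite (linear_forZ (linBr _)) ef eqxx /= mulr1 addr0 mulN1r addNr.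
by rewrite (linear_forZ (linBr _)) ef eq_sym => /negPf-> /=; rewrite mulr0.
Qed.

End DualBases.
End BilinearForms.

Section CoinvariantForms.
Variables (k : fieldType) (K : algType k) (Delta : K -> seq (K * K)).
Variables (eps : K -> k) (S : K -> K).
Hypothesis hopfK : is_hopf Delta eps S.
Variables (V : lmodType k) (rho : V -> seq (K * V)).
Hypothesis comodV : is_comodule Delta eps rho.

Definition coinvariant_form (B : V -> V -> k) : Prop :=
  forall x y, \tsum_(a, z <- rho x) \tsum_(b, w <- rho y) B z w *: (a * b) = B x y *: 1.

Lemma coinvariant_coef_mx (B : V -> V -> k) (U U' : V -> Prop) m (e f : 'I_m -> V)
    (xi zeta : 'I_m -> V -> k) :
  bilinear_form B -> coinvariant_form B -> subcomodule rho U -> subcomodule rho U' ->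
  coord_basis U e xi -> coord_basis U' f zeta ->
  (forall i j, B (e i) (f j) = (i == j)%:R) ->
  coef_mx rho e xi *m (coef_mx rho f zeta)^T = 1%:M.
Proof.
move=> [linBl linBr] invB subU subU' basisU basisU' ef.
have [[Ue _ _ _] [U'f _ _ _]] := (basisU, basisU').
apply/matrixP => i j; rewrite !mxE -[RHS]scaler_nat -ef -invB.
rewrite (coact_expand subU basisU) //; last by multilinear.
apply: eq_bigr => s _; rewrite (coact_expand subU' basisU') //; last by multilinear.
rewrite (bigD1 s) //= ef eqxx scale1r big1 ?addr0 => [|t]; first by rewrite !mxE.
by rewrite ef eq_sym => /negPf->; rewrite scale0r.
Qed.

(* Let Y and G be the matrices of the coaction on dual bases of U and U'.  Coinvariance
   of B gives Y G^T = 1, and that of lam B with its arguments swapped gives G Y^T = 1. *)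
Lemma coinvariant_form_antipode_involutive (B : V -> V -> k) (U U' : V -> Prop) m
    (e f : 'I_m -> V) lam :
  bilinear_form B -> coinvariant_form B -> subcomodule rho U -> subcomodule rho U' ->
  coord_basis U e (fun i => B^~ (f i)) -> coord_basis U' f (fun i => B (e i)) ->
  (forall x y, U x -> U' y -> B x y = lam * B y x) ->
  inner_faithful Delta S rho U -> forall x, S (S x) = x.
Proof.
move=> formB invB subU subU' basisU basisU' nakayamaB innerU.
have [[Ue _ _ _] [U'f _ _ ef]] := (basisU, basisU').
have comatrixG := coef_comatrix (hopf_coalgebra hopfK) comodV subU' basisU'.
apply: (inner_faithful_antipode_involutive hopfK comodV subU basisU innerU comatrixG).
  exact: (coinvariant_coef_mx formB invB subU subU').
apply: (coinvariant_coef_mx (B := fun x y => lam * B x y) _ _ subU' subU) => //.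
- have [linBl linBr] := formB.
  by split=> z a x y; rewrite ?linBl ?linBr mulrDr mulrCA.
- move=> x y; rewrite -scalerA -invB scaler_tsumr; apply: eq_tsum => a z.
  by rewrite scaler_tsumr; apply: eq_tsum => b w; rewrite scalerA.
- by move=> i j; rewrite -nakayamaB // ef eq_sym.
Qed.

End CoinvariantForms.

(** * Graded Frobenius comodule algebras *)

Section GradedFrobenius.
Variables (k : fieldType) (E : falgType k) (Eg : nat -> {vspace E}).
Variable B : E -> E -> k.
Hypothesis grE : is_conn_graded Eg.
Hypothesis frobB : is_graded_frobenius_form Eg B.

Definition top_degree (d : nat) : Prop :=
  Eg d != 0%VS /\ forall i, (d < i)%N -> Eg i = 0%VS.

Lemma graded_ind (P : E -> Prop) :
  (forall x y, P x -> P y -> P (x + y)) -> (forall i x, x \in Eg i -> P x) ->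
  forall x, P x.
Proof.
move=> PD Phom x; case: grE => _ [n sumE] _ _.
have : x \in (\sum_(i < n) Eg i)%VS by rewrite sumE memvf.
case/memv_sumP => v vE ->; apply: big_ind => // [|i _].
  by apply: (Phom 0%N); apply: mem0v.
by apply: (Phom i); apply: vE.
Qed.

Lemma frobenius_bilinear_form : bilinear_form B.
Proof. by case: frobB => [[Bl Br] _ _ _]; split=> z a x y; [apply: Bl | apply: Br]. Qed.

Let linBl := proj1 frobenius_bilinear_form.
Let linBr := proj2 frobenius_bilinear_form.

Lemma frobenius_nondegl x : (forall j y, y \in Eg j -> B x y = 0) -> x = 0.
Proof.
case: frobB => _ _ [nondeg _] _ Bx; apply: nondeg.
apply: (graded_ind (P := fun y => B x y = 0)) => // y z By Bz.
by rewrite (linear_forD (linBr x)) By Bz addr0.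
Qed.

Lemma frobenius_nondegr y : (forall i x, x \in Eg i -> B x y = 0) -> y = 0.
Proof.
case: frobB => _ _ [_ nondeg] _ By; apply: nondeg.
apply: (graded_ind (P := fun x => B x y = 0)) => // x z Bx Bz.
by rewrite (linear_forD (linBl y)) Bx Bz addr0.
Qed.

Lemma frobenius_top_degree : exists d : nat, top_degree d /\
  forall i j x y, x \in Eg i -> y \in Eg j -> (i + j != d)%N -> B x y = 0.
Proof.
have [_ _ _ [d Bd]] := frobB; have [_ _ _ E0] := grE; exists d; split=> //; split.
- apply/eqP=> Ed0; have /eqP[] := oner_neq0 E; apply: frobenius_nondegl => j y jy.
  have [jd | jd] := eqVneq j d.
    by move: jy; rewrite jd Ed0 memv0 => /eqP->; apply: linear_for0 (linBr 1).
  by apply: (Bd 0%N j) => //; rewrite E0 memv_line.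
- move=> i di; apply/eqP; rewrite -subv0; apply/subvP=> x ix; rewrite memv0.
  apply/eqP/frobenius_nondegl => j y jy; apply: (Bd i j) => //.
  by rewrite neq_ltn (leq_trans di) ?leq_addr ?orbT.
Qed.

Lemma frobenius_perfect_pairing i : exists j, perfect_pairing B (Eg i) (Eg j).
Proof.
have [d [[_ Etop] Bd]] := frobenius_top_degree; have [id | di] := leqP i d; last first.
  by exists i; rewrite Etop //; split=> x; rewrite memv0 => /eqP.
exists (d - i)%N; split=> [x ix Bx | y iy By].
  apply: frobenius_nondegl => j y jy; have [jdi | jdi] := eqVneq j (d - i)%N.
    by apply: Bx; rewrite -jdi.
  by apply: (Bd i j) => //; apply: contra_neq jdi => <-; rewrite addKn.
apply: frobenius_nondegr => j x jx; have [ji | ji] := eqVneq j i.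
  by apply: By; rewrite -ji.
by apply: (Bd j (d - i)%N) => //; rewrite -[X in _ != X](subnKC id) eqn_add2r.
Qed.

Variables (K : algType k) (Delta : K -> seq (K * K)) (eps : K -> k) (S : K -> K).
Variable rho : E -> seq (K * E).
Hypothesis hopfK : is_hopf Delta eps S.
Hypothesis comodE : is_comod_alg Delta eps rho.
Hypothesis rho_graded : forall i, subcomodule rho (fun x => x \in Eg i).

Definition codeterminant_trivial : Prop :=
  forall d, top_degree d -> forall x, x \in Eg d -> x != 0 -> teq (rho x) [:: (1, x)].

Hypothesis codetE : codeterminant_trivial.

Lemma comod_alg_comodule : is_comodule Delta eps rho.
Proof. by case: comodE. Qed.

Let comoduleE := comod_alg_comodule.

Lemma top_degree_functional_invariant d (xi : E -> k) x :
  top_degree d -> scalar xi -> (forall i y, y \in Eg i -> i != d -> xi y = 0) ->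
  coef rho xi x = xi x *: 1.
Proof.
move=> top_d lxi xi0; have lc := coef_linear comoduleE lxi.
move: x; apply: graded_ind => [x y cx cy | i x ix].
  by rewrite (linear_forD lc) (linear_forD lxi) scalerDl cx cy.
have [id | id] := eqVneq i d; last first.
  have [s [rho_s sE]] := rho_graded ix; rewrite (xi0 i) // scale0r.
  have -> : coef rho xi x = \tsum_(a, z <- s) xi z *: a by apply: rho_s; multilinear.
  by rewrite /tsum big_seq big1 // => p /sE/xi0-> //; rewrite scale0r.
have [-> | x0] := eqVneq x 0; first by rewrite (linear_for0 lc) (linear_for0 lxi) scale0r.
have -> : coef rho xi x = \tsum_(a, z <- [:: (1, x)]) xi z *: a.
  by apply: (codetE top_d) => //; [rewrite -id | multilinear].
by rewrite /tsum big_seq1.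
Qed.

Lemma frobenius_form_coinvariant : coinvariant_form rho B.
Proof.
move=> x y; have [_ Bassoc _ _] := frobB; have [_ _ _ rhoM _] := comodE.
have [d [top_d Bd]] := frobenius_top_degree; have l1 := linBl 1.
rewrite -[y in RHS]mulr1 -Bassoc.
rewrite -(top_degree_functional_invariant _ top_d l1); last first.
  move=> i z iz id; apply: (Bd i 0%N) => //; last by rewrite addn0.
  by have [_ _ _ ->] := grE; apply: memv_line.
have bB : bilin (fun (a : K) z => B z 1 *: a) by multilinear.
rewrite /coef /tsum (rhoM x y K _ bB) big_allpairs_dep /=.
by apply: eq_bigr => p _; apply: eq_bigr => q _; rewrite Bassoc mulr1.
Qed.

Lemma frobenius_antipode_involutive i :
  (exists mu : E -> E, is_nakayama B mu /\
     exists lam : k, forall a, a \in Eg i -> mu a = lam *: a) ->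
  inner_faithful Delta S rho (fun x => x \in Eg i) -> forall x, S (S x) = x.
Proof.
move=> [mu [nakayama [lam mu_lam]]] inner; have formB := frobenius_bilinear_form.
have [j pairing_ij] := frobenius_perfect_pairing i.
have [m [e [f [basis_e basis_f]]]] := dual_bases formB pairing_ij.
apply: (coinvariant_form_antipode_involutive hopfK comoduleE formB
  frobenius_form_coinvariant (@rho_graded i) (@rho_graded j) basis_e basis_f _ inner).
by move=> x y ix _; rewrite nakayama mu_lam // (linear_forZ (linBr y)).
Qed.

End GradedFrobenius.

(** * Maschke's theorem for comodules *)

Section Maschke.
Variables (k : fieldType) (K : algType k) (Delta : K -> seq (K * K)).
Variables (eps : K -> k) (S : K -> K).
Hypothesis hopfK : is_hopf Delta eps S.

Definition left_integral (lam : K -> k) : Prop :=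
  scalar lam /\ forall x, \tsum_(a, c <- Delta x) lam c *: a = lam x *: 1.

Variable lam : K -> k.
Hypothesis integral_lam : left_integral lam.
Hypothesis lam1 : lam 1 = 1.

Variables (V : lmodType k) (rho : V -> seq (K * V)).
Hypothesis comodV : is_comodule Delta eps rho.

Let coalgK := hopf_coalgebra hopfK.
Let S_linear := antipode_linear hopfK.
Let lam_scalar : scalar lam := proj1 integral_lam.

Definition colinear (phi : V -> V) : Prop :=
  linear phi /\ forall (W : lmodType k) (f : K -> V -> W) x, bilin f ->
    tsum f (rho (phi x)) = \tsum_(a, z <- rho x) f a (phi z).

Definition coact_retraction (u : K) (z : V) : V :=
  \tsum_(c, d <- rho z) lam (u * S c) *: d.

Lemma coact_retraction_bilin : bilin coact_retraction.
Proof. by rewrite /coact_retraction; multilinear. Qed.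

(* Invariance of lam rewrites lam (u S(c)) 1 as the coproduct of u S(c); the factor S(c)_1
   of the latter then cancels against the next component of the coaction. *)
Lemma coact_retraction_colinear (W : lmodType k) (f : K -> V -> W) u z : bilin f ->
  tsum f (rho (coact_retraction u z))
  = \tsum_(a, c <- Delta u) f a (coact_retraction c z).
Proof.
move=> bf; have lrho : linear (fun y => tsum f (rho y)) by multilinear.
rewrite (linear_for_tsum lrho).
transitivity (\tsum_(c, p <- rho z) \tsum_(a, d <- Delta (u * S c))
    \tsum_(q, r <- rho p) lam d *: f (a * q) r).
  apply: eq_tsum => c p; rewrite (linear_forZ lrho) /= scaler_tsumr tsum_exchange.
  apply: eq_tsum => q r; have lg : linear (fun y => f (y * q) r) by multilinear.
  rewrite -[q in LHS]mul1r -(linear_forZ lg) /= -(proj2 integral_lam).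
  by rewrite (linear_for_tsum lg); apply: eq_tsum => a d; rewrite (linear_forZ lg).
transitivity (\tsum_(a, d <- Delta u) \tsum_(c, p <- rho z) \tsum_(s, t <- Delta c)
    \tsum_(q, r <- rho p) lam (d * S s) *: f (a * (S t * q)) r).
  rewrite [RHS]tsum_exchange; apply: eq_tsum => c p.
  rewrite (comulM hopfK); last by multilinear.
  apply: eq_tsum => a d; rewrite (comul_antipode hopfK); last by multilinear.
  by do 2!apply: eq_tsum => ? ?; rewrite mulrA.
apply: eq_tsum => a d.
rewrite (coact_cancel_middle comodV (mu := fun t q => S t * q) (u := 1)
  (f := fun s y r => lam (d * S s) *: f (a * y) r)) => [|||]; try by multilinear.
  rewrite /coact_retraction bilin_tsumr //.
  by apply: eq_tsum => s r; rewrite bilinZr // mulr1.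
by move=> y; apply: (antipodel hopfK y (@linear_id _ _)).
Qed.

Lemma coact_retractionK x : tsum coact_retraction (rho x) = x.
Proof.
rewrite /coact_retraction -(coact_coassoc comodV (f := fun a c d => lam (a * S c) *: d));
  last by multilinear.
rewrite -[RHS](coact_counit comodV x (@linear_id _ _)); apply: eq_tsum => p d.
rewrite (antipoder hopfK (g := fun y => lam y *: d)); last by multilinear.
by rewrite lam1 scale1r.
Qed.

Definition average (theta : V -> V) (x : V) : V :=
  \tsum_(a, d <- rho x) coact_retraction a (theta d).

Lemma average_colinear theta : linear theta -> colinear (average theta).
Proof.
move=> ltheta; have retraction_bilin := coact_retraction_bilin.
split=> [|W f x bf]; first by rewrite /average; multilinear.
have lrho : linear (fun y => tsum f (rho y)) by multilinear.
rewrite (linear_for_tsum lrho).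
transitivity (\tsum_(p, d <- rho x) \tsum_(a, c <- Delta p)
    f a (coact_retraction c (theta d))).
  by apply: eq_tsum => p d; rewrite coact_retraction_colinear.
rewrite (coact_coassoc comodV (f := fun a c d => f a (coact_retraction c (theta d))));
  last by multilinear.
by apply: eq_tsum => a p; rewrite bilin_tsumr.
Qed.

End Maschke.

(** * Semisimplicity of the dual algebra *)

Lemma fin_dim_coord_basis (k : fieldType) (V : lmodType k) n : fin_dim_with V n ->
  exists (b : 'I_n -> V) (xi : 'I_n -> V -> k), coord_basis (fun _ => True) b xi.
Proof.
case=> b [b_free b_span].
have coords x : exists c : {ffun 'I_n -> k}, x == \sum_i c i *: b i.
  have [c xE] := b_span x; exists [ffun i => c i]; apply/eqP.
  by rewrite [LHS]xE; apply: eq_bigr => i _; rewrite ffunE.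
pose xi i x := xchoose (coords x) i.
have xiE x : x = \sum_i xi i x *: b i by apply/eqP/(xchooseP (coords x)).
have xi_unique c x : x = \sum_i c i *: b i -> forall i, xi i x = c i.
  move=> xE i; apply/eqP; rewrite -subr_eq0; apply/eqP.
  apply: (b_free (fun i => xi i x - c i)).
  by under eq_bigr do rewrite scalerBl; rewrite sumrB -xiE -xE subrr.
exists b, xi; split=> // [i a x y | i j].
  apply: (xi_unique (fun i => a * xi i x + xi i y)).
  under eq_bigr do rewrite scalerDl -scalerA.
  by rewrite big_split -scaler_sumr -!xiE.
apply: (xi_unique (fun i => (i == j)%:R)).
rewrite (bigD1 j) //= eqxx scale1r big1 ?addr0 // => l /negPf->.
by rewrite scale0r.
Qed.

Lemma fin_dim_gt0 (k : fieldType) (K : algType k) n : fin_dim_with K n -> (0 < n)%N.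
Proof.
case: n => // -[b [_ /(_ 1)[c]]]; rewrite big_ord0 => /eqP.
by rewrite oner_eq0.
Qed.

Lemma row_subspace_matrix (k : fieldType) n (P : 'rV[k]_n -> Prop) :
  P 0 -> (forall a u v, P u -> P v -> P (a *: u + v)) ->
  exists M : 'M[k]_n, forall v, P v <-> (v <= M)%MS.
Proof.
move=> P0 P_linear.
pose attained r := `[< exists2 M : 'M[k]_n, forall v, (v <= M)%MS -> P v & \rank M = r >].
have ex_rank : exists r, attained r.
  exists 0%N; apply/asboolP; exists 0; last exact: mxrank0.
  by move=> v; rewrite submx0 => /eqP->.
have rank_le r : attained r -> (r <= n)%N.
  by move/asboolP=> [M _ <-]; apply: rank_leq_row.
case: (ex_maxnP ex_rank rank_le) => r /asboolP[M MP rankM] max_r.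
exists M => v; split=> [Pv | /MP //]; apply: contrapT => /negP vM.
have /max_r : attained (\rank (M + v)%MS).
  apply/asboolP; exists (M + v)%MS => // u /sub_addsmxP[[c1 c2] /= ->].
  by rewrite addrC [c2]mx11_scalar mul_scalar_mx; apply/P_linear/MP/submxMl.
apply/negP; rewrite -ltnNge -rankM; apply: rank_ltmx.
by rewrite ltmxE addsmxSl addsmx_sub submx_refl.
Qed.

Section DualSpace.
Variables (k : fieldType) (V : lmodType k) (n : nat).
Variables (b : 'I_n -> V) (xi : 'I_n -> V -> k).
Hypothesis basisV : coord_basis (fun _ => True) b xi.

Let xi_scalar i : scalar (xi i). Proof. by case: basisV. Qed.

Let spanV x : x = \sum_i xi i x *: b i.
Proof. by case: basisV => _ _ b_span _; apply: b_span. Qed.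

Definition row_functional (v : 'rV[k]_n) : V -> k := fun x => \sum_i v 0 i * xi i x.

Lemma scalar_row_functional f : scalar f -> f = row_functional (\row_i f (b i)).
Proof.
move=> lf; apply/funext => x; rewrite {1}(spanV x) (linear_for_sum lf).
by apply: eq_bigr => i _; rewrite (linear_forZ lf) mxE /= mulrC.
Qed.

Lemma dual_subspace_projection (I : (V -> k) -> Prop) :
  (forall f, I f -> scalar f) -> I (fun _ => 0) ->
  (forall f g, I f -> I g -> I (fun x => f x + g x)) ->
  (forall a f, I f -> I (fun x => a * f x)) ->
  exists theta : V -> V,
    [/\ linear theta, forall f, scalar f -> I (fun x => f (theta x)) &
        forall f, I f -> forall x, f (theta x) = f x].
Proof.
move=> I_scalar I0 ID IZ.
have [||M MP] := @row_subspace_matrix k n (fun v => I (row_functional v)).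
- suff -> : row_functional 0 = fun _ => 0 by [].
  by apply/funext=> x; apply: big1 => i _; rewrite mxE mul0r.
- move=> a u v Iu Iv.
  suff -> : row_functional (a *: u + v) =
      fun x => a * row_functional u x + row_functional v x.
    exact: ID (IZ _ _ Iu) Iv.
  apply/funext=> x; rewrite mulr_sumr -big_split; apply: eq_bigr => i _.
  by rewrite !mxE mulrDl mulrA.
pose Q := pinvmx M *m M; pose theta x := \sum_j xi j x *: \sum_i Q i j *: b i.
have thetaE f : scalar f ->
    (fun x => f (theta x)) = row_functional (\row_i f (b i) *m Q).
  move=> lf; apply/funext=> x; rewrite (linear_for_sum lf); apply: eq_bigr => j _.
  rewrite (linear_forZ lf) (linear_for_sum lf) /= mulrC mxE; congr (_ * _).
  by apply: eq_bigr => i _; rewrite (linear_forZ lf) !mxE /= mulrC.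
exists theta; split=> [|f lf|f If x].
- by apply: linear_for_big => j; apply: linear_scalel.
- by rewrite thetaE //; apply/MP; rewrite mulmxA submxMl.
have lf := I_scalar f If; rewrite -[LHS]/((fun x => f (theta x)) x) thetaE //.
rewrite [in RHS](scalar_row_functional lf) mulmxA mulmxKpV //.
by apply/MP; rewrite -scalar_row_functional.
Qed.

End DualSpace.

Section DualSemisimple.
Variables (k : fieldType) (K : algType k) (Delta : K -> seq (K * K)).
Variables (eps : K -> k) (S : K -> K).
Hypothesis hopfK : is_hopf Delta eps S.

Let coalgK := hopf_coalgebra hopfK.
Let comodK := regular_comodule coalgK.
Let S_linear := antipode_linear hopfK.

Lemma conv_scalar (f g : K -> k) : scalar f -> scalar g -> scalar (conv Delta f g).
Proof.
move=> lf lg.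
exact: (linear_coact comodK (bilin_mul_scalar lf lg) (@linear_id _ _)).
Qed.

Lemma colinear_kernel_left_ideal phi : colinear Delta phi ->
  dual_left_ideal Delta (fun f => scalar f /\ forall x, f (phi x) = 0).
Proof.
move=> [_ Dphi]; split=> [f [] // | | f g [lf f0] [lg g0] | a f [lf f0] | h f lh [lf f0]].
- by split=> // a x y; rewrite mulr0 addr0.
- by split=> [a x y | x]; [rewrite lf lg mulrDr addrACA | rewrite f0 g0 addr0].
- by split=> [c x y | x]; [rewrite lf mulrDr mulrCA | rewrite f0 mulr0].
split=> [|x]; first exact: conv_scalar.
have -> : conv Delta h f (phi x) = \tsum_(c, d <- Delta x) h c * f (phi d).
  exact: (Dphi _ _ x (bilin_mul_scalar lh lf)).
by apply: big1 => p _; rewrite f0 mulr0.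
Qed.

Variable lam : K -> k.
Hypothesis integral_lam : left_integral Delta lam.
Hypothesis lam1 : lam 1 = 1.
Variables (n : nat) (b : 'I_n -> K) (xi : 'I_n -> K -> k).
Hypothesis basisK : coord_basis (fun _ => True) b xi.

Let lam_scalar : scalar lam := proj1 integral_lam.
Local Notation retraction := (coact_retraction S lam Delta).
Local Notation average := (average S lam Delta).

Section LeftIdeal.
Variables (I : (K -> k) -> Prop) (theta : K -> K).
Hypothesis idealI : dual_left_ideal Delta I.
Hypothesis theta_mem : forall f, scalar f -> I (fun x => f (theta x)).
Hypothesis theta_id : forall f, I f -> forall x, f (theta x) = f x.

Lemma left_ideal_sum J (r : seq J) (F : J -> K -> k) :
  (forall j, I (F j)) -> I (fun x => \sum_(j <- r) F j x).
Proof.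
have [_ I0 ID _ _] := idealI; move=> IF; elim: r => [|j r Ir].
  suff -> : (fun x => \sum_(i <- [::]) F i x) = fun _ => 0 by [].
  by apply/funext=> x; rewrite big_nil.
suff -> : (fun x => \sum_(i <- j :: r) F i x) = fun x => F j x + \sum_(i <- r) F i x.
  exact: ID.
by apply/funext=> x; rewrite big_cons.
Qed.

Lemma left_ideal_retraction f u : I f -> I (fun z => f (retraction u z)).
Proof.
have [I_scalar _ _ _ I_conv] := idealI; move=> If; have lf := I_scalar f If.
suff -> : (fun z => f (retraction u z)) = conv Delta (fun c => lam (u * S c)) f.
  by apply: I_conv => //; apply: (linear_for_comp lam_scalar); multilinear.
apply/funext=> z; rewrite (linear_for_tsum lf).
by apply: eq_bigr => p _; rewrite (linear_forZ lf).
Qed.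

Lemma left_ideal_average_id f x : I f -> f (average theta x) = f x.
Proof.
move=> If; have [/(_ f If) lf _ _ _ _] := idealI.
rewrite -[in RHS](coact_retractionK hopfK integral_lam lam1 comodK x).
rewrite !(linear_for_tsum lf); apply: eq_tsum => a d.
exact: (theta_id (left_ideal_retraction a If)).
Qed.

Lemma left_ideal_average_mem f : scalar f -> I (fun x => f (average theta x)).
Proof.
move=> lf; have [_ _ _ _ I_conv] := idealI; have [_ xi_scalar spanK _] := basisK.
have retraction_bilin := coact_retraction_bilin hopfK integral_lam comodK.
suff -> : (fun x => f (average theta x))
    = fun x => \sum_i conv Delta (xi i) (fun z => f (retraction (b i) (theta z))) x.
  apply: left_ideal_sum => i; apply: I_conv; first exact: xi_scalar.
  by apply: (theta_mem (f := fun z => f (retraction (b i) z))); multilinear.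
apply/funext=> x; rewrite (linear_for_tsum lf) /tsum exchange_big.
apply: eq_bigr => p _ /=; have lg : scalar (fun u => f (retraction u (theta p.2))).
  by multilinear.
rewrite {1}(spanK p.1) // (linear_for_sum lg).
by apply: eq_bigr => i _; rewrite (linear_forZ lg).
Qed.

End LeftIdeal.

Lemma normalized_integral_dual_semisimple : dual_semisimple Delta.
Proof.
move=> I idealI; have [I_scalar I0 ID IZ _] := idealI.
have [theta [ltheta theta_mem theta_id]] :=
  dual_subspace_projection basisK I_scalar I0 ID IZ.
have colinear_average := average_colinear hopfK integral_lam comodK ltheta.
have average_id f x : I f -> f (average theta x) = f x.
  exact: left_ideal_average_id.
have average_mem f : scalar f -> I (fun x => f (average theta x)).
  exact: left_ideal_average_mem.
exists (fun f => scalar f /\ forall x, f (average theta x) = 0); split.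
- exact: colinear_kernel_left_ideal.
- by move=> f If [_ f0] x; rewrite -(average_id f x If).
move=> f lf; exists (fun x => f (average theta x)), (fun x => f x - f (average theta x)).
split=> [||x]; [exact: average_mem | split=> [a x y | x] | by rewrite addrC subrK].
  by rewrite (proj1 colinear_average) !lf mulrBr opprD addrACA.
by rewrite (average_id _ x (average_mem f lf)) subrr.
Qed.

End DualSemisimple.

Section RegularTrace.
Variables (k : fieldType) (K : algType k) (Delta : K -> seq (K * K)).
Variables (eps : K -> k) (S : K -> K).
Hypothesis hopfK : is_hopf Delta eps S.
Hypothesis S_involutive : forall x, S (S x) = x.

Let coalgK := hopf_coalgebra hopfK.
Let comodK := regular_comodule coalgK.
Let S_linear := antipode_linear hopfK.

Lemma antipode_swap (W : lmodType k) (g : K -> W) x : linear g ->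
  \tsum_(a, c <- Delta x) g (c * S a) = eps x *: g 1.
Proof.
move=> lg; rewrite -(antipode1 hopfK) -(antipoder hopfK (g := fun z => g (S z)));
  last by multilinear.
by apply: eq_tsum => a c; rewrite (antipodeM hopfK) S_involutive.
Qed.

Lemma comul_mulr_untwist (W : lmodType k) (f : K -> K -> W) x y : bilin f ->
  \tsum_(p, q <- Delta y) \tsum_(a, c <- Delta (x * q)) f (a * S p) c
  = \tsum_(a, c <- Delta x) f a (c * y).
Proof.
move=> bf.
transitivity (\tsum_(a, c <- Delta x) \tsum_(p, q <- Delta y) \tsum_(r, s <- Delta q)
    f (a * (r * S p)) (c * s)).
  rewrite [RHS]tsum_exchange; apply: eq_tsum => p q.
  rewrite (comulM hopfK); last by multilinear.
  by do 2!apply: eq_tsum => ? ?; rewrite mulrA.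
apply: eq_tsum => a c.
rewrite -(coact_coassoc comodK (f := fun p r s => f (a * (r * S p)) (c * s)));
  last by multilinear.
rewrite -(coact_counit comodK (g := fun z => f a (c * z))); last by multilinear.
apply: eq_tsum => p s.
rewrite (antipode_swap (g := fun z => f (a * z) (c * s))) ?mulr1 //.
by multilinear.
Qed.

Variables (n : nat) (b : 'I_n -> K) (xi : 'I_n -> K -> k).
Hypothesis basisK : coord_basis (fun _ => True) b xi.

Let xi_scalar i : scalar (xi i). Proof. by case: basisK. Qed.
Let xi_b i j : xi i (b j) = (i == j)%:R. Proof. by case: basisK. Qed.

Definition regular_trace (x : K) : k := \sum_i xi i (x * b i).

Lemma regular_trace_scalar : scalar regular_trace.
Proof.
by apply: linear_for_big => i; apply: (linear_for_comp (xi_scalar i)); multilinear.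
Qed.

Lemma regular_trace1 : regular_trace 1 = n%:R.
Proof.
rewrite /regular_trace; under eq_bigr do rewrite mul1r xi_b eqxx.
by rewrite sumr_const card_ord.
Qed.

(* By comul_mulr_untwist the left-hand side is the trace of L C S(C), where L is the
   matrix of left multiplication by x and C that of the coproduct, and C S(C) = 1. *)
Lemma regular_trace_integral : left_integral Delta regular_trace.
Proof.
split=> [|x]; first exact: regular_trace_scalar.
have subK : subcomodule Delta (fun _ => True) by move=> y _; exists (Delta y).
pose C := coef_mx Delta b xi.
have CSC l j : \sum_i C l i * S (C i j) = (l == j)%:R.
  have cC : comatrix Delta eps C := coef_comatrix coalgK comodK subK basisK.
  have /matrixP/(_ l j) := comatrix_antipoder hopfK cC; rewrite !mxE => <-.
  by apply: eq_bigr => i _; rewrite [map_mx S C i j]mxE.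
transitivity (\sum_i \sum_j coef Delta (xi i) (x * b j) * S (C i j)).
  transitivity (\sum_i \tsum_(a, c <- Delta x) xi i (c * b i) *: a).
    by rewrite /tsum [RHS]exchange_big; apply: eq_bigr => p _; rewrite scaler_suml.
  apply: eq_bigr => i _.
  rewrite -(comul_mulr_untwist (f := fun a c => xi i c *: a)); last by multilinear.
  rewrite (coact_expand subK basisK) //; last by multilinear.
  apply: eq_bigr => j _; rewrite /C mxE.
  by rewrite /coef /tsum mulr_suml; apply: eq_bigr => p _; rewrite scalerAl.
rewrite exchange_big /regular_trace scaler_suml; apply: eq_bigr => j _ /=.
transitivity (\sum_l xi l (x * b j) *: \sum_i C l i * S (C i j)).
  transitivity (\sum_i \sum_l xi l (x * b j) *: (C l i * S (C i j))).
    apply: eq_bigr => i _; rewrite (coef_expand comodK basisK) // mulr_suml.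
    by apply: eq_bigr => l _; rewrite -scalerAl /C !mxE.
  by rewrite exchange_big; apply: eq_bigr => l _; rewrite scaler_sumr.
rewrite (bigD1 j) //= CSC eqxx big1 ?addr0 // => l /negPf lj.
by rewrite CSC lj scaler0.
Qed.

Lemma involutive_antipode_dual_semisimple : n%:R != 0 :> k -> dual_semisimple Delta.
Proof.
move=> n0; pose lam x := n%:R^-1 * regular_trace x.
have [tr_scalar tr_integral] := regular_trace_integral.
apply: (normalized_integral_dual_semisimple hopfK (lam := lam) _ _ basisK).
- split=> [a x y | x]; first by rewrite /lam tr_scalar mulrDr mulrCA.
  rewrite /lam -scalerA -tr_integral scaler_tsumr.
  by apply: eq_tsum => a c; rewrite scalerA.
- by rewrite /lam regular_trace1 mulVf.
Qed.

End RegularTrace.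

Theorem theorem3p3 (k : fieldType)
    (E : falgType k) (Eg : nat -> {vspace E}) (B : E -> E -> k)
    (K : algType k) (Delta : K -> seq (K * K)) (eps : K -> k) (S : K -> K)
    (rho : E -> seq (K * E)) :
  (* E connected graded Frobenius *)
  is_conn_graded Eg ->
  is_graded_frobenius_form Eg B ->
  (* Nakayama automorphism restricts to a scalar on E_1 *)
  (exists mu : E -> E, is_nakayama B mu /\
     exists lam : k, forall a, a \in Eg 1%N -> mu a = lam *: a) ->
  (* K Hopf, E left K-comodule algebra *)
  is_hopf Delta eps S ->
  is_comod_alg Delta eps rho ->
  (* grading-preserving coaction *)
  (forall i x, x \in Eg i -> exists s, teq (rho x) s /\
                 forall p, p \in s -> p.2 \in Eg i) ->
  (* inner-faithful on E_1 *)
  (forall K' : K -> Prop, is_hopf_subalg Delta S K' -> (exists x, ~ K' x) ->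
     exists e, e \in Eg 1%N /\
       ~ (exists s, teq (rho e) s /\ forall p, p \in s -> K' p.1 /\ p.2 \in Eg 1%N)) ->
  (* trivial homological codeterminant: rho(e) = 1 (x) e for e spanning the top degree *)
  (forall d, Eg d != 0%VS -> (forall i, (d < i)%N -> Eg i = 0%VS) ->
     forall e, e \in Eg d -> e != 0 -> teq (rho e) [:: (1, e)]) ->
  (forall x, S (S x) = x) /\
  (forall n, fin_dim_with K n -> (forall p, p \in [pchar k] -> ~~ (p %| n)%N) ->
     dual_semisimple Delta).
Proof.
move=> grE frobB nakayama hopfK comodE rho_graded inner codet.
have codetE : codeterminant_trivial Eg rho by move=> d [Ed Etop]; apply: codet.
have S_involutive : forall x, S (S x) = x.
  exact: (frobenius_antipode_involutive grE frobB hopfK comodE rho_graded codetE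
    nakayama inner).
split=> // n dimK pchar_n.
have [b [xi basisK]] := fin_dim_coord_basis dimK.
apply: (involutive_antipode_dual_semisimple hopfK S_involutive basisK).
rewrite natf_neq0_pchar; apply/pnatP => [|p _ pn]; first exact: fin_dim_gt0 dimK.
by apply/negP => /pchar_n; rewrite pn.
Qed.
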